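(* Let $\Delta$ be a bidual assignment and let $X$ and $Y$ be Banach spaces. If $X$ embeds into $Y$ with distortion at most $\lambda$, then $\mathcal S_\Delta(X)$ embeds into $\mathcal S_\Delta(Y)$ with distortion at most $2\lambda$. If $X$ and $Y$ are linearly isomorphic with distortion at most $\lambda$, then $\mathcal S_\Delta(X)$ and $\mathcal S_\Delta(Y)$ are linearly isomorphic with distortion at most $\lambda$.
   Context: Banach spaces are real, and $X$ is identified with its canonical image in $X^{**}$. A bidual assignment is a rule $\Delta$ assigning to each Banach space $X$ a closed linear subspace $X\subset\Delta(X)\subset X^{**}$ such that $T^{**}(\Delta(X))\subset\Delta(Y)$ for every bounded linear operator $T:X\to Y$. The derivative of $X$ with respect to $\Delta$ is the quotient Banach space $\mathcal S_\Delta(X)=\Delta(X)/X$. $X$ embeds into $Y$ (resp. is isomorphic to $Y$) with distortion at most $\lambda$ if there is a linear isomorphism $T$ from $X$ onto a closed subspace $T(X)$ of $Y$ (resp. onto $Y$) with $\|T\|\,\|T^{-1}\|\leq\lambda$, where $T^{-1}$ is defined on the range of $T$. *)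

(* Defs.v *)
From HB Require Import structures.
From mathcomp Require Import all_boot all_order all_algebra.
From mathcomp Require Import generic_quotient ring_quotient.
From mathcomp Require Import boolp classical_sets functions reals.
From mathcomp Require Import topology normedtype sequences.

Set Implicit Arguments.
Unset Strict Implicit.
Unset Printing Implicit Defensive.

Import Order.TTheory GRing.Theory Num.Theory.
Import numFieldNormedType.Exports.

Local Open Scope classical_set_scope.
Local Open Scope ring_scope.

Section BoundedOperators.
Context {R : realType} {X Y : normedModType R}.

Definition bounded_linear : {pred X -> Y} := fun f : X -> Y =>
  `[< linear f /\ exists M : R, forall x, `|f x| <= M * `|x| >].

Lemma bounded_linearP (f : X -> Y) : reflect
  (linear f /\ exists M : R, forall x, `|f x| <= M * `|x|)
  (f \in bounded_linear).
Proof. exact: asboolP. Qed.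

Lemma bounded_linear_submod : submod_closed bounded_linear.
Proof.
split.
  apply/bounded_linearP; split; first by move=> a u v; rewrite /= scaler0 addr0.
  by exists 0 => x; rewrite normr0 mul0r.
move=> a f g /bounded_linearP[lf [M fM]] /bounded_linearP[lg [N gN]].
apply/bounded_linearP; split.
  move=> b u v.
  change (a *: f (b *: u + v) + g (b *: u + v) =
    b *: (a *: f u + g u) + (a *: f v + g v)).
  by rewrite lf lg !scalerDr !scalerA mulrC addrACA.
exists (`|a| * M + N) => x.
change (`|a *: f x + g x| <= (`|a| * M + N) * `|x|).
rewrite (le_trans (ler_normD _ _))// mulrDl lerD// normrZ -mulrA.
by rewrite ler_wpM2l.
Qed.

Record boundedOp := BoundedOp {
  boundedOp_fun :> X -> Y;
  _ : boundedOp_fun \in bounded_linear }.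

HB.instance Definition _ := [isSub for boundedOp_fun].
HB.instance Definition _ := [Choice of boundedOp by <:].
HB.instance Definition _ := GRing.isSubmodClosed.Build R (X -> Y)
  bounded_linear bounded_linear_submod.
HB.instance Definition _ := [SubChoice_isSubLmodule of boundedOp by <:].

Implicit Types f g : boundedOp.

Lemma boundedOp_linear f : linear f.
Proof. by case: f => f /= /bounded_linearP[]. Qed.

HB.instance Definition _ f :=
  GRing.isLinear.Build R X Y *:%R f (boundedOp_linear f).

Lemma boundedOpP f g : f =1 g -> f = g.
Proof. by move=> fg; apply/val_inj/funext. Qed.

Definition opnorm f : R := sup [set `|f x| | x in [set x | `|x| <= 1]].

Lemma opnorm_has_sup f : has_sup [set `|f x| | x in [set x | `|x| <= 1]].
Proof.
split; first by exists `|f 0|, 0 => //=; rewrite normr0.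
case: f => f /= /bounded_linearP[_ [M fM]].
exists `|M| => _ [x /= x1 <-]; rewrite (le_trans (fM x))//.
rewrite (le_trans (ler_wpM2r _ (ler_norm M)))//.
by rewrite ler_piMr.
Qed.

Lemma opnorm_ge0 f : 0 <= opnorm f.
Proof.
apply: (@le_trans _ _ `|f 0|) => //.
by apply: (sup_upper_bound (opnorm_has_sup f)); exists 0 => //=; rewrite normr0.
Qed.

Lemma ler_opnorm f x : `|f x| <= opnorm f * `|x|.
Proof.
have [->|x0] := eqVneq x 0; first by rewrite linear0 !normr0 mulr0.
have nx0 : 0 < `|x| by rewrite normr_gt0.
rewrite -ler_pdivrMr//.
apply: (sup_upper_bound (opnorm_has_sup f)).
exists (`|x|^-1 *: x); first by rewrite /= normrZ normfV normr_id mulVf ?gt_eqF.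
by rewrite linearZ/= normrZ normfV normr_id mulrC.
Qed.

Lemma opnorm_le f (M : R) : 0 <= M -> (forall x, `|f x| <= M * `|x|) ->
  opnorm f <= M.
Proof.
move=> M0 fM; apply: ge_sup; first exact: (opnorm_has_sup f).1.
move=> _ [x /= x1 <-]; rewrite (le_trans (fM x))//.
by rewrite ler_piMr.
Qed.

Lemma opnorm_triangle f g : opnorm (f + g) <= opnorm f + opnorm g.
Proof.
apply: opnorm_le => [|x]; first by rewrite addr_ge0 ?opnorm_ge0.
change (`|f x + g x| <= (opnorm f + opnorm g) * `|x|).
by rewrite (le_trans (ler_normD _ _))// mulrDl lerD ?ler_opnorm.
Qed.

Lemma opnormZ (a : R) f : opnorm (a *: f) = `|a| * opnorm f.
Proof.
have le b h : opnorm (b *: h) <= `|b| * opnorm h.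
  apply: opnorm_le => [|x]; first by rewrite mulr_ge0 ?opnorm_ge0.
  change (`|b *: h x| <= `|b| * opnorm h * `|x|).
  by rewrite normrZ -mulrA ler_wpM2l ?ler_opnorm.
apply/eqP; rewrite eq_le le/=.
have [->|a0] := eqVneq a 0; first by rewrite normr0 mul0r opnorm_ge0.
rewrite -[f in leLHS](scalerK a0) -ler_pdivlMl ?normr_gt0//.
by rewrite -normfV le.
Qed.

Lemma opnorm0_eq0 f : opnorm f = 0 -> f = 0.
Proof.
move=> f0; apply: boundedOpP => x; apply/eqP; rewrite -normr_le0.
by rewrite (le_trans (ler_opnorm f x))// f0 mul0r.
Qed.

HB.instance Definition _ := Lmodule_isNormed.Build R boundedOp
  opnorm_triangle opnormZ opnorm0_eq0.

Lemma boundedOp_normE f : `|f| = opnorm f.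
Proof. by []. Qed.

Lemma ler_boundedOp f x : `|f x| <= `|f| * `|x|.
Proof. exact: ler_opnorm. Qed.

Lemma boundedOp_norm_le f (M : R) : 0 <= M -> (forall x, `|f x| <= M * `|x|) ->
  `|f| <= M.
Proof. exact: opnorm_le. Qed.

End BoundedOperators.
Arguments boundedOp {R} X Y.

Lemma half_expr_gt0 {R : realType} n : 0 < 2^-1 ^+ n :> R.
Proof. by rewrite exprn_gt0 ?invr_gt0. Qed.

Lemma half_expr_lt {R : realType} (e : R) : 0 < e ->
  exists n, forall m, (n <= m)%N -> 2^-1 ^+ m < e.
Proof.
move=> e0; have : (fun n => 2^-1 ^+ n : R) @ \oo --> (0 : R).
  by apply: cvg_expr; rewrite ger0_norm ?invr_ge0// invf_lt1 ?ltr1n.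
move=> /cvgrPdist_lt /(_ _ e0)[n _ ne]; exists n => m /ne /=.
by rewrite sub0r normrN ger0_norm// ltW// half_expr_gt0.
Qed.

Section CompletenessCriterion.
Context {R : realType} {V : normedModType R}.

Lemma rapidly_cauchy_complete :
  (forall u : nat -> V, (forall n m, (n <= m)%N -> `|u n - u m| <= 2^-1 ^+ n) ->
    exists l : V, u @ \oo --> l) ->
  forall F : set_system V, ProperFilter F -> cauchy F -> cvg F.
Proof.
move=> Vcvg F FF /cauchy_ballP Fc.
have /choice[A FA] : forall n : nat, exists A : set V,
    F A /\ forall x y, A x -> A y -> `|x - y| <= 2^-1 ^+ n.
  move=> n; have /Fc := @half_expr_gt0 R n.
  case=> -[B C] /= [FB FC] BC.
  have /Fc : 0 < 2^-1 ^+ n / 2 :> R by rewrite divr_gt0// half_expr_gt0.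
  case=> -[B' C'] /= [FB' FC'] BC'.
  exists (B' `&` C'); split; first exact: filterI.
  have [z [_ Cz]] := filter_ex (filterI FB' FC').
  move=> x y [Bx _] [By _].
  have := BC' (x, z) (conj Bx Cz); have := BC' (y, z) (conj By Cz).
  rewrite /= -!ball_normE /= => yz xz.
  rewrite (le_trans (ler_distD z _ _))// [leRHS]splitr.
  by rewrite lerD// ltW// distrC.
pose B n := \bigcap_(k in [set k | (k <= n)%N]) A k.
have FB n : F (B n).
  elim: n => [|n ih].
    by apply: filterS (FA 0).1 => x A0x k /=; rewrite leqn0 => /eqP ->.
  apply: filterS (filterI ih (FA n.+1).1) => x [Bx Ax] k /=.
  rewrite leq_eqVlt => /orP[/eqP->//|]; rewrite ltnS => kn; exact: Bx.
have /choice[u Bu] : forall n, exists x, B n x by move=> n; exact: filter_ex (FB n).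
have [n m nm|l ul] := Vcvg u.
  by apply: (FA n).2; [apply: Bu => /=|exact: Bu].
apply/cvg_ex; exists l; apply/cvgrPdist_le => /= e e0.
have e20 : 0 < e / 2 by rewrite divr_gt0.
have [n /(_ n (leqnn n)) ne] := half_expr_lt e20.
have : \forall m \near \oo, `|l - u m| <= e / 2.
  by move/cvgrPdist_le : ul; apply; rewrite divr_gt0.
case=> m _ /(_ (maxn m n)) /= /(_ (leq_maxl _ _)) lum.
apply: filterS (FA n).1 => x Ax.
rewrite (le_trans (ler_distD (u (maxn m n)) _ _))// [leRHS]splitr.
rewrite lerD// (le_trans _ (ltW ne))//; apply: (FA n).2 => //.
by apply: Bu => /=; exact: leq_maxr.
Qed.

Lemma rapidly_cauchy_cvg (V' : completeNormedModType R) (u : nat -> V') :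
  (forall n m, (n <= m)%N -> `|u n - u m| <= 2^-1 ^+ n) ->
  exists l : V', u @ \oo --> l.
Proof.
move=> uc; apply/cvg_ex; apply: cauchy_cvg; apply/cauchy_ballP => e e0.
have e20 : 0 < e / 2 by rewrite divr_gt0.
have [n /(_ n (leqnn n)) ne] := half_expr_lt e20.
exists ([set x | exists2 m, (n <= m)%N & u m = x],
        [set x | exists2 m, (n <= m)%N & u m = x]) => /=.
  by split; exists n => //= k nk; exists k.
move=> [_ _] /= [[m nm <-] [k nk <-]]; rewrite -ball_normE /=.
rewrite (le_lt_trans (ler_distD (u n) _ _))// [ltRHS]splitr ltr_leD//.
  by rewrite distrC (le_lt_trans (uc _ _ nm)).
by rewrite (le_trans (uc _ _ nk))// ltW.
Qed.

End CompletenessCriterion.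

Section BoundedOperatorsComplete.
Context {R : realType} {X : normedModType R} {Y : completeNormedModType R}.

Lemma boundedOp_complete (F : set_system (boundedOp X Y)) :
  ProperFilter F -> cauchy F -> cvg F.
Proof.
apply: rapidly_cauchy_complete => u uc {F}.
have ucx x n m : (n <= m)%N -> `|u n x - u m x| <= 2^-1 ^+ n * `|x|.
  by move=> nm; rewrite (le_trans (ler_boundedOp (u n - u m) x))// ler_wpM2r// uc.
have /choice[f uf] : forall x, exists l : Y, u ^~ x @ \oo --> l.
  move=> x; have [->|x0] := eqVneq x 0.
    exists 0; rewrite (_ : u ^~ 0 = cst 0); first exact: cvg_cst.
    by apply/funext => n; rewrite linear0.
  have nx0 : 0 < `|x| by rewrite normr_gt0.
  have [n m nm|l] := @rapidly_cauchy_cvg _ Y (fun n => u n (`|x|^-1 *: x)).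
    rewrite (le_trans (ucx _ _ _ nm))// normrZ normfV normr_id mulVf ?gt_eqF//.
    by rewrite mulr1.
  move=> ul; exists (`|x| *: l).
  have -> : u ^~ x = (fun n => `|x| *: u n (`|x|^-1 *: x)).
    by apply/funext => n; rewrite linearZ/= scalerA mulfV ?scale1r// gt_eqF.
  exact: cvgZl_tmp.
have fl : linear f.
  move=> a x y; apply: (cvg_unique _ (uf (a *: x + y))); first exact: norm_hausdorff.
  rewrite (_ : u ^~ _ = (fun n => a *: u n x + u n y)); last first.
    by apply/funext => n; rewrite linearD linearZ.
  by apply: cvgD => //; exact: cvgZl_tmp.
have fu n x : `|u n x - f x| <= 2^-1 ^+ n * `|x|.
  have un : (fun m => `|u n x - u m x|) @ \oo --> `|u n x - f x|.
    by apply: cvg_norm; apply: cvgB => //; exact: cvg_cst.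
  apply: (@cvgr_to_le _ _ _ _ _ _ _ un).
  by exists n => // m /= nm; exact: ucx.
have fP : f \in bounded_linear.
  apply/bounded_linearP; split=> //.
  exists (`|u 0| + 1) => x; rewrite mulrDl.
  rewrite -[f x](subrK (u 0%N x)) addrC (le_trans (ler_normD _ _))// lerD//.
    exact: ler_boundedOp.
  by rewrite distrC (le_trans (fu _ _)).
exists (BoundedOp fP); apply/cvgrPdist_le => /= e e0.
have [n ne] := half_expr_lt e0; exists n => //= m /ne/ltW /=; apply: le_trans.
apply: boundedOp_norm_le => [|x]; first exact/ltW/half_expr_gt0.
by rewrite distrC; exact: (fu m x).
Qed.

HB.instance Definition _ :=
  Uniform_isComplete.Build (boundedOp X Y) boundedOp_complete.

End BoundedOperatorsComplete.

Section ClosedSubspaces.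
Context {R : realType} {V : normedModType R}.

Record closedSubspace := ClosedSubspace {
  closedSubspace_set :> V -> Prop;
  closedSubspace0 : closedSubspace_set 0;
  closedSubspaceZD : forall (a : R) u v, closedSubspace_set u ->
    closedSubspace_set v -> closedSubspace_set (a *: u + v);
  closedSubspace_closed : closed closedSubspace_set }.

(* Boolean form of membership, which the algebraic subtype and quotient
   structures require. *)
Definition closedSubspace_pred (W : closedSubspace) : {pred V} :=
  fun v => `[< W v >].

Lemma closedSubspace_predP (W : closedSubspace) v :
  reflect (W v) (v \in closedSubspace_pred W).
Proof. exact: asboolP. Qed.

Lemma closedSubspace_submod W : submod_closed (closedSubspace_pred W).
Proof.
split; first exact/closedSubspace_predP/closedSubspace0.
move=> a u v /closedSubspace_predP Wu /closedSubspace_predP Wv.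
exact/closedSubspace_predP/closedSubspaceZD.
Qed.

HB.instance Definition _ W := GRing.isSubmodClosed.Build R V
  (closedSubspace_pred W) (closedSubspace_submod W).

(* A closed subspace as a normed space of its own, with the induced norm. *)
Record subspaceType (W : closedSubspace) := SubspaceType {
  subspace_val :> V;
  _ : subspace_val \in closedSubspace_pred W }.

Section Subspace.
Variable W : closedSubspace.

HB.instance Definition _ := [isSub for @subspace_val W].
HB.instance Definition _ := [Choice of subspaceType W by <:].
HB.instance Definition _ := [SubChoice_isSubLmodule of subspaceType W by <:].

Definition subspace_norm (w : subspaceType W) : R := `|subspace_val w|.

Lemma subspace_norm_triangle v w :
  subspace_norm (v + w) <= subspace_norm v + subspace_norm w.
Proof. exact: ler_normD. Qed.

Lemma subspace_normZ (a : R) w :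
  subspace_norm (a *: w) = `|a| * subspace_norm w.
Proof. exact: normrZ. Qed.

Lemma subspace_norm0_eq0 w : subspace_norm w = 0 -> w = 0.
Proof. by move=> /normr0_eq0 w0; exact: val_inj. Qed.

HB.instance Definition _ := Lmodule_isNormed.Build R (subspaceType W)
  subspace_norm_triangle subspace_normZ subspace_norm0_eq0.

Lemma subspace_normE (w : subspaceType W) : `|w| = `|subspace_val w|.
Proof. by []. Qed.

Lemma subspace_valP (w : subspaceType W) : W w.
Proof. by case: w => w /= /closedSubspace_predP. Qed.

End Subspace.
End ClosedSubspaces.
Arguments closedSubspace {R} V.

Section ClosedSubspacesComplete.
Context {R : realType} {V : completeNormedModType R} (W : closedSubspace V).

Lemma subspace_complete (F : set_system (subspaceType W)) :
  ProperFilter F -> cauchy F -> cvg F.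
Proof.
apply: rapidly_cauchy_complete => u uc {F}.
have [l ul] := @rapidly_cauchy_cvg _ V (fun n => subspace_val (u n)) uc.
have Wl : W l.
  apply: (closed_cvg _ (@closedSubspace_closed _ _ W) _ _ ul).
  by apply: nearW => n; exact: subspace_valP.
have Wl' : l \in closedSubspace_pred W by exact/closedSubspace_predP.
exists (SubspaceType Wl'); apply/cvgrPdist_le => e e0.
by move/cvgrPdist_le : ul => /(_ _ e0).
Qed.

HB.instance Definition _ :=
  Uniform_isComplete.Build (subspaceType W) subspace_complete.

End ClosedSubspacesComplete.

Section Quotients.
Context {R : realType} {V : normedModType R}.
Variable W : closedSubspace V.
Local Open Scope quotient_scope.

Definition quotientSpace : Type := Quotient.quot (closedSubspace_pred W).

HB.instance Definition _ := Choice.on quotientSpace.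
HB.instance Definition _ := GRing.Zmodule.on quotientSpace.

Definition quotient_proj (v : V) : quotientSpace :=
  \pi_(Quotient.quot (closedSubspace_pred W)) v.

Lemma quotient_projP q : exists v, quotient_proj v = q.
Proof. by exists (repr q); exact: reprK. Qed.

Lemma eq_quotient_proj u v : quotient_proj u = quotient_proj v <-> W (u - v).
Proof.
split=> [/eqP|Wuv]; first by rewrite -Quotient.idealrBE => /closedSubspace_predP.
by apply/eqP; rewrite -Quotient.idealrBE; exact/closedSubspace_predP.
Qed.

Lemma quotient_projD u v :
  quotient_proj (u + v) = quotient_proj u + quotient_proj v.
Proof. exact: raddfD. Qed.

Definition quotient_scale (a : R) (q : quotientSpace) : quotientSpace :=
  quotient_proj (a *: repr q).

Lemma quotient_scaleE a v :
  quotient_scale a (quotient_proj v) = quotient_proj (a *: v).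
Proof.
apply/eq_quotient_proj; rewrite -scalerBr -[_ *: _]addr0.
apply: closedSubspaceZD; last exact: closedSubspace0.
by apply/eq_quotient_proj; rewrite [LHS]reprK.
Qed.

Lemma quotient_scaleA a b q :
  quotient_scale a (quotient_scale b q) = quotient_scale (a * b) q.
Proof.
by have [v <-] := quotient_projP q; rewrite !quotient_scaleE scalerA.
Qed.

Lemma quotient_scale1 : left_id 1 quotient_scale.
Proof.
by move=> q; have [v <-] := quotient_projP q; rewrite quotient_scaleE scale1r.
Qed.

Lemma quotient_scaleDr : right_distributive quotient_scale +%R.
Proof.
move=> a p q; have [u <-] := quotient_projP p; have [v <-] := quotient_projP q.
by rewrite -quotient_projD !quotient_scaleE scalerDr quotient_projD.
Qed.

Lemma quotient_scaleDl q : {morph quotient_scale^~ q : a b / a + b}.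
Proof.
move=> a b; have [v <-] := quotient_projP q.
by rewrite !quotient_scaleE scalerDl quotient_projD.
Qed.

HB.instance Definition _ := GRing.Zmodule_isLmodule.Build R quotientSpace
  quotient_scaleA quotient_scale1 quotient_scaleDr quotient_scaleDl.

Lemma quotient_proj_linear : linear quotient_proj.
Proof.
by move=> a u v; rewrite quotient_projD; congr (_ + _); rewrite -quotient_scaleE.
Qed.

HB.instance Definition _ :=
  GRing.isLinear.Build R V quotientSpace *:%R quotient_proj
    quotient_proj_linear.

Definition quotient_norm (q : quotientSpace) : R :=
  inf [set `|v| | v in [set v | quotient_proj v = q]].

Lemma quotient_norm_has_inf q :
  has_inf [set `|v| | v in [set v | quotient_proj v = q]].
Proof.
split; first by have [v vq] := quotient_projP q; exists `|v|, v.
by exists 0 => _ [v _ <-].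
Qed.

Lemma quotient_norm_ge0 q : 0 <= quotient_norm q.
Proof.
apply: lb_le_inf; first exact: (quotient_norm_has_inf q).1.
by move=> _ [v _ <-].
Qed.

Lemma quotient_norm_le v : quotient_norm (quotient_proj v) <= `|v|.
Proof. by apply: (inf_lbound (quotient_norm_has_inf _).2); exists v. Qed.

Lemma quotient_norm_lift q (e : R) : 0 < e ->
  exists2 v, quotient_proj v = q & `|v| < quotient_norm q + e.
Proof.
move=> e0; have [_ [v vq <-] ve] := inf_adherent e0 (quotient_norm_has_inf q).
by exists v.
Qed.

Lemma quotient_norm_triangle p q :
  quotient_norm (p + q) <= quotient_norm p + quotient_norm q.
Proof.
apply/ler_addgt0Pr => e e0.
have e20 : 0 < e / 2 by rewrite divr_gt0.
have [u <- ue] := quotient_norm_lift p e20.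
have [v <- ve] := quotient_norm_lift q e20.
rewrite -quotient_projD (le_trans (quotient_norm_le _))//.
rewrite (le_trans (ler_normD _ _))// [e]splitr addrACA.
by rewrite lerD// ltW.
Qed.

Lemma quotient_normZ (a : R) q :
  quotient_norm (a *: q) = `|a| * quotient_norm q.
Proof.
have le b p : quotient_norm (b *: p) <= `|b| * quotient_norm p.
  apply/ler_addgt0Pr => e e0.
  have e20 : 0 < e / (`|b| + 1) by rewrite divr_gt0// ltr_wpDl.
  have [u <- ue] := quotient_norm_lift p e20.
  rewrite -linearZ (le_trans (quotient_norm_le _))// normrZ.
  rewrite (le_trans (ler_wpM2l _ (ltW ue)))// mulrDr lerD2l.
  by rewrite mulrCA ler_piMr ?(ltW e0)// ler_pdivrMr ?ltr_wpDl// mul1r lerDl.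
apply/eqP; rewrite eq_le le/=.
have [->|a0] := eqVneq a 0; first by rewrite normr0 mul0r quotient_norm_ge0.
rewrite -[q in leLHS](scalerK a0) -ler_pdivlMl ?normr_gt0//.
by rewrite -normfV le.
Qed.

Lemma quotient_norm0_eq0 q : quotient_norm q = 0 -> q = 0.
Proof.
have [v <-] := quotient_projP q => v0.
rewrite -(linear0 quotient_proj); apply/eq_quotient_proj; rewrite subr0.
apply: (@closedSubspace_closed _ _ W) => B /nbhs_normP[e /= e0 eB].
have [u uv] := quotient_norm_lift (quotient_proj v) e0.
rewrite v0 add0r => ue; exists (v - u); split; last first.
  by apply: eB; rewrite /= opprB addrC subrK.
by apply/eq_quotient_proj.
Qed.

HB.instance Definition _ := Lmodule_isNormed.Build R quotientSpace
  quotient_norm_triangle quotient_normZ quotient_norm0_eq0.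

Lemma quotient_normE (q : quotientSpace) :
  `|q| = inf [set `|v| | v in [set v | quotient_proj v = q]].
Proof. by []. Qed.

Lemma quotient_proj_norm v : `|quotient_proj v| <= `|v|.
Proof. exact: quotient_norm_le. Qed.


End Quotients.

Section QuotientsComplete.
Context {R : realType} {V : completeNormedModType R} (W : closedSubspace V).

Lemma quotient_complete (F : set_system (quotientSpace W)) :
  ProperFilter F -> cauchy F -> cvg F.
Proof.
apply: rapidly_cauchy_complete => u uc {F}.
pose c (n : nat) : R := 2^-1 ^+ n.
have cS n : c n = c n.+1 + c n.+1.
  by rewrite /c exprSr -splitr.
have /choice[f fP] : forall nv : nat * V, exists w : V,
    quotient_proj W nv.2 = u nv.1.+2 ->
    quotient_proj W w = u nv.1.+3 /\ `|nv.2 - w| <= c nv.1.+1.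
  move=> [n v] /=; have [vu|] := pselect (quotient_proj W v = u n.+2); last first.
    by exists v.
  have [x xu xe] := quotient_norm_lift (u n.+2 - u n.+3) (half_expr_gt0 n.+2).
  exists (v - x) => _; split.
    by rewrite linearB/= xu vu opprB addrC subrK.
  rewrite opprB addrC subrK (le_trans (ltW xe))// (cS n.+1) lerD2r.
  exact: (uc n.+2 n.+3).
have [w0 w0u] := quotient_projP (u 2).
pose w := fix w n := if n is k.+1 then f (k, w k) else w0.
have wu n : quotient_proj W (w n) = u n.+2.
  by elim: n => [//|n /(fP (n, _))[]].
have wS n : `|w n - w n.+1| <= c n.+1 by have /(fP (n, _))[] := wu n.
have wc n k : `|w n - w (n + k)%N| <= c n - c (n + k)%N.
  elim: k => [|k ih]; first by rewrite addn0 !subrr normr0.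
  rewrite addnS (le_trans (ler_distD (w (n + k)%N) _ _))//.
  by rewrite (le_trans (lerD ih (wS _)))// (cS (n + k)%N) opprD addrA subrK.
have [n m /subnKC <-|l wl] := @rapidly_cauchy_cvg _ V w.
  by rewrite (le_trans (wc _ _))// gerBl; exact/ltW/half_expr_gt0.
exists (quotient_proj W l); apply/cvgrPdist_le => e e0.
move/cvgrPdist_le : wl => /(_ _ e0)[N _ Nw]; exists N.+2 => // n /= Nn.
have -> : u n = quotient_proj W (w n.-2) by rewrite wu; case: n Nn => [|[|]].
rewrite -linearB (le_trans (quotient_proj_norm _ _))//.
by apply: Nw; case: n Nn => [|[|]].
Qed.

HB.instance Definition _ :=
  Uniform_isComplete.Build (quotientSpace W) quotient_complete.

End QuotientsComplete.

(* A graph here is a set of pairs in V * R, that is, a partial functional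
   that need not a priori be single-valued. *)
Definition linear_graph {R : realType} {V : lmodType R} (G : set (V * R)) :=
  forall (a : R) u v r s, G (u, r) -> G (v, s) -> G (a *: u + v, a * r + s).

Definition dominated_graph {R : realType} {V : lmodType R} (p : V -> R)
    (G : set (V * R)) :=
  forall u r, G (u, r) -> r <= p u.

Section HahnBanach.
Context {R : realType} {V : lmodType R} (p : V -> R).
Hypothesis p_subadditive : forall u v, p (u + v) <= p u + p v.
Hypothesis p_homogeneous : forall (a : R) v, 0 <= a -> p (a *: v) = a * p v.

Lemma hahn_banach (G0 : set (V * R)) : G0 !=set0 ->
  linear_graph G0 -> dominated_graph p G0 ->
  exists f : V -> R^o, [/\ linear f, forall v, f v <= p v &
    forall u r, G0 (u, r) -> f u = r].
Proof.
move=> G0n G0l G0d.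
pose P A := [/\ linear_graph A, dominated_graph p A & A !=set0 -> G0 `<=` A].
have [F FP Ftot|A [[Al Ad AG0] Amax]] := @Zorn_bigcup _ P.
  split.
  - move=> a u v r s [A FA Au] [B FB Bv].
    have [AB|BA] := Ftot A B FA FB.
      by exists B => //; have [Bl _ _] := FP B FB; apply: Bl => //; exact: AB.
    by exists A => //; have [Al _ _] := FP A FA; apply: Al => //; exact: BA.
  - by move=> u r [A FA Au]; have [_ Ad _] := FP A FA; exact: Ad.
  - move=> [x [A FA Ax]]; have [_ _ AG] := FP A FA.
    by move=> y G0y; exists A => //; apply: AG => //; exists x.
have [[u0 r0] Au0] : A !=set0.
  apply: contrapT => A0; apply: (Amax G0); last by split=> // _ x.
  split; first by move=> x Ax; exfalso; apply: A0; exists x.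
  by case: G0n => x G0x /(_ x G0x) Ax; apply: A0; exists x.
have {}AG0 : G0 `<=` A by apply: AG0; exists (u0, r0).
have A00 : A (0, 0).
  have := Al (-1) _ _ _ _ Au0 Au0.
  by rewrite scaleN1r mulN1r !addNr.
have AZ a u r : A (u, r) -> A (a *: u, a * r).
  by move=> Au; have := Al a _ _ _ _ Au A00; rewrite !addr0.
have AD u v r s : A (u, r) -> A (v, s) -> A (u + v, r + s).
  by move=> Au Av; have := Al 1 _ _ _ _ Au Av; rewrite scale1r mul1r.
have p0 : p 0 = 0 by rewrite -(scale0r (0 : V)) p_homogeneous// mul0r.
have Afun u r s : A (u, r) -> A (u, s) -> r = s.
  have le r' s' : A (u, r') -> A (u, s') -> r' <= s'.
    move=> Ar /(AZ (-1)); rewrite scaleN1r mulN1r => /(AD _ _ _ _ Ar)/Ad.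
    by rewrite subrr p0 subr_le0.
  by move=> Ar As; apply/eqP; rewrite eq_le !le.
have Atot v : exists r : R^o, A (v, r).
  apply: contrapT => nAv.
  pose S := [set ur.2 - p (ur.1 - v) | ur in A].
  have Sub w s : A (w, s) -> ubound S (p (w + v) - s).
    move=> Aw _ [[u r] Au /= <-].
    rewrite lerBlDr addrAC lerBrDr.
    rewrite (le_trans (Ad _ _ (AD _ _ _ _ Au Aw)))//.
    rewrite (_ : u + w = (w + v) + (u - v)); first exact: p_subadditive.
    by rewrite [RHS]addrC -addrA [w + v]addrC addKr.
  have Ssup : has_sup S.
    split; first by exists (r0 - p (u0 - v)), (u0, r0).
    by exists (p (0 + v) - 0); exact: Sub.
  pose c := sup S.
  pose B := [set ws : V * R | exists u r t,
    A (u, r) /\ ws = (u + t *: v, r + t * c)].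
  have AB : A `<=` B.
    by move=> [u r] Au; exists u, r, 0; rewrite scale0r mul0r !addr0.
  apply: (Amax B).
    split=> // BA; apply: nAv; exists c; apply: BA.
    by exists 0, 0, 1; rewrite scale1r mul1r !add0r.
  split.
  - move=> a w1 w2 s1 s2 [u1 [r1 [t1 [Au1 [-> ->]]]]] [u2 [r2 [t2 [Au2 [-> ->]]]]].
    exists (a *: u1 + u2), (a * r1 + r2), (a * t1 + t2); split; first exact: Al.
    rewrite scalerDr mulrDr addrACA scalerA -scalerDl.
    by rewrite addrACA mulrA -mulrDl.
  - move=> _ _ [u [r [t [Au [-> ->]]]]].
    have [t0|t0|->] := ltgtP t 0; last by rewrite scale0r mul0r !addr0 Ad.
    + have k0 : 0 < - t by rewrite oppr_gt0.
      have : (- t)^-1 * r - p ((- t)^-1 *: u - v) <= c.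
        apply: (sup_upper_bound Ssup).
        by exists ((- t)^-1 *: u, (- t)^-1 * r) => //; exact: AZ.
      rewrite -(ler_pM2l k0) mulrBr mulVKf ?gt_eqF//.
      rewrite -(p_homogeneous _ (ltW k0)).
      rewrite scalerBr scalerA mulfV ?gt_eqF// scale1r scaleNr opprK.
      by rewrite mulNr lerBlDr addrC -lerBlDr opprK.
    + have : c <= p (t^-1 *: u + v) - t^-1 * r.
        by apply: ge_sup; [exact: Ssup.1|exact: Sub (AZ _ _ _ Au)].
      rewrite -(ler_pM2l t0) mulrBr mulVKf ?gt_eqF//.
      rewrite -(p_homogeneous _ (ltW t0)).
      rewrite scalerDr scalerA mulfV ?gt_eqF// scale1r.
      by rewrite lerBrDr addrC.
  - by move=> _; exact: subset_trans AG0 AB.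
have /choice[f Af] := Atot.
exists f; split.
- by move=> a u v; apply: (Afun (a *: u + v)); [exact: Af|exact: Al].
- by move=> v; exact: Ad.
- by move=> u r /AG0; exact: Afun.
Qed.

End HahnBanach.

Section Duals.
Context {R : realType}.

(* R^o is R seen as a Banach space over itself. *)
Definition dual (X : normedModType R) : completeNormedModType R :=
  boundedOp X R^o.

Definition bidual (X : normedModType R) : completeNormedModType R :=
  dual (dual X).

Lemma mk_boundedOp_subproof (X Y : normedModType R) (f : X -> Y) (M : R) :
  linear f -> (forall x, `|f x| <= M * `|x|) -> f \in bounded_linear.
Proof. by move=> fl fM; apply/bounded_linearP; split=> //; exists M. Qed.

Section Adjoint.
Context {X Y : normedModType R}.

Lemma adjoint_fun_subproof (T : boundedOp X Y) (g : dual Y) :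
  (fun x => g (T x) : R^o) \in bounded_linear.
Proof.
apply: (@mk_boundedOp_subproof _ _ _ (`|g| * `|T|)) => [a u v|x].
  by rewrite !linearP.
rewrite (le_trans (ler_boundedOp g _))// -mulrA ler_wpM2l//.
exact: (ler_boundedOp T).
Qed.

Definition adjoint_fun (T : boundedOp X Y) (g : dual Y) : dual X :=
  BoundedOp (adjoint_fun_subproof T g).

Lemma adjoint_subproof (T : boundedOp X Y) :
  adjoint_fun T \in bounded_linear.
Proof.
apply: (@mk_boundedOp_subproof _ _ _ `|T|) => [a g h|g].
  exact: boundedOpP.
apply: boundedOp_norm_le => [|x]; first by rewrite mulr_ge0.
rewrite (le_trans (ler_boundedOp g _))// [`|T| * _]mulrC -mulrA ler_wpM2l//.
exact: (ler_boundedOp T).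
Qed.

Definition adjoint (T : boundedOp X Y) : boundedOp (dual Y) (dual X) :=
  BoundedOp (adjoint_subproof T).

Lemma adjointE T g x : adjoint T g x = g (T x).
Proof. by []. Qed.

End Adjoint.

Definition biadjoint {X Y : normedModType R} (T : boundedOp X Y) :
  boundedOp (bidual X) (bidual Y) := adjoint (adjoint T).

Section CanonicalEmbedding.
Context {X : normedModType R}.

Lemma canonical_subproof (x : X) :
  (fun f : dual X => f x : R^o) \in bounded_linear.
Proof.
apply: (@mk_boundedOp_subproof _ _ _ `|x|) => [//|f].
by rewrite mulrC; exact: (ler_boundedOp f).
Qed.

Definition canonical (x : X) : bidual X := BoundedOp (canonical_subproof x).

Lemma canonicalE x (f : dual X) : canonical x f = f x.
Proof. by []. Qed.

Lemma canonical_linear : linear canonical.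
Proof.
move=> a u v; apply: boundedOpP => f.
change (f (a *: u + v) = a *: f u + f v); exact: linearP.
Qed.

HB.instance Definition _ :=
  GRing.isLinear.Build R X (bidual X) *:%R canonical canonical_linear.

Lemma norming_functional (x : X) :
  exists f : dual X, (forall y, `|f y| <= `|y|) /\ f x = `|x|.
Proof.
have pZ (a : R) (v : X) : 0 <= a -> `|a *: v| = a * `|v|.
  by move=> a0; rewrite normrZ ger0_norm.
pose G0 := [set ws : X * R | exists a : R, ws = (a *: x, a * `|x|)].
have [| | |f [fl fp fG]] := hahn_banach (@ler_normD _ X) pZ (G0 := G0).
- by exists (0, 0); exists 0; rewrite scale0r mul0r.
- move=> a u v r s [b [-> ->]] [c [-> ->]]; exists (a * b + c).
  by rewrite scalerDl scalerA mulrDl mulrA.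
- by move=> _ _ [a [-> ->]]; rewrite normrZ ler_wpM2r// ler_norm.
have fn y : `|f y| <= 1 * `|y|.
  rewrite mul1r ler_norml fp andbT lerNl -[`|y|]normrN.
  have fN : f (- y) = - f y.
    have := fl (-1) y 0; have := fl (-1) 0 0.
    rewrite !scaleN1r !addr0 oppr0 => f0.
    have -> : f 0 = 0 by rewrite f0 addNr.
    by rewrite addr0.
  by rewrite -fN fp.
have fb : f \in bounded_linear by exact: mk_boundedOp_subproof fl fn.
exists (BoundedOp fb); split=> [y|]; first by rewrite -[leRHS]mul1r; exact: fn.
by apply: fG; exists 1; rewrite scale1r mul1r.
Qed.

Lemma canonical_norm x : `|canonical x| = `|x|.
Proof.
apply/eqP; rewrite eq_le; apply/andP; split.
  apply: boundedOp_norm_le => // f; rewrite mulrC; exact: (ler_boundedOp f).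
have [f [f1 fx]] := norming_functional x.
rewrite -[leLHS]normr_id -fx (le_trans (ler_boundedOp (canonical x) f))//.
rewrite ler_piMr//; apply: boundedOp_norm_le => // y.
by rewrite mul1r.
Qed.

End CanonicalEmbedding.

Lemma canonical_range_closed (X : completeNormedModType R) :
  closed (range (@canonical X)).
Proof.
move=> phi phic.
have /choice[x xphi] : forall n, exists x : X,
    `|phi - canonical x| < 2^-1 ^+ n.+1.
  move=> n; have [_ [[x _ <-] xphi]] : range (@canonical X) `&`
      [set psi | `|phi - psi| < 2^-1 ^+ n.+1] !=set0.
    by apply: phic; rewrite -nbhs_nbhs_norm; exists (2^-1 ^+ n.+1) => //=;
      exact: half_expr_gt0.
  by exists x.
have [n m nm|l xl] := @rapidly_cauchy_cvg _ X x.
  rewrite -canonical_norm linearB (le_trans (ler_distD phi _ _))//.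
  rewrite distrC [leRHS]splitr -exprSr; apply: lerD; first exact: ltW (xphi n).
  apply: (le_trans (ltW (xphi m))).
  by rewrite ler_wiXn2l ?invr_ge0 ?invf_le1 ?ler1n.
exists l => //; apply/eqP; rewrite -subr_eq0 -normr_le0.
apply/ler_addgt0Pr => e e0; rewrite add0r; have e20 : 0 < e / 2 by rewrite divr_gt0.
have [N Ne] := half_expr_lt e20.
move/cvgrPdist_le : xl => /(_ _ e20)[M _ Me].
pose k := maxn N M.
rewrite (le_trans (ler_distD (canonical (x k)) _ _))// [leRHS]splitr lerD//.
  by rewrite -linearB canonical_norm Me//= leq_maxr.
by rewrite distrC ltW// (lt_trans (xphi k))// Ne// leqW// leq_maxl.
Qed.

End Duals.

Record bidualAssignment (R : realType) := BidualAssignment {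
  assignment :> forall X : completeNormedModType R, closedSubspace (bidual X);
  assignment_canonical : forall (X : completeNormedModType R) (x : X),
    assignment X (canonical x);
  assignment_biadjoint : forall (X Y : completeNormedModType R)
    (T : boundedOp X Y) (phi : bidual X),
    assignment X phi -> assignment Y (biadjoint T phi) }.

Section Derivative.
Context {R : realType} (Delta : bidualAssignment R).
Variable X : completeNormedModType R.

(* The copy of X inside the Banach space Delta X. *)
Definition canonical_image : set (subspaceType (Delta X)) :=
  [set phi | exists x, canonical x = subspace_val phi].

Lemma canonical_image0 : canonical_image 0.
Proof. by exists 0; rewrite linear0. Qed.

Lemma canonical_imageZD (a : R) phi psi :
  canonical_image phi -> canonical_image psi ->
  canonical_image (a *: phi + psi).
Proof.
by move=> [x xphi] [y ypsi]; exists (a *: x + y); rewrite linearP/= xphi ypsi.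
Qed.

Lemma canonical_image_closed : closed canonical_image.
Proof.
move=> phi phic; have [x _ xphi] : range (@canonical R X) (subspace_val phi).
  apply: canonical_range_closed => B /nbhs_normP[e /= e0 eB].
  have [psi [[x xpsi] phipsi]] : canonical_image `&`
      [set psi | `|phi - psi| < e] !=set0.
    by apply: phic; rewrite -nbhs_nbhs_norm; exists e.
  by exists (subspace_val psi); split; [exists x|exact: eB].
by exists x.
Qed.

Definition canonical_image_subspace : closedSubspace (subspaceType (Delta X)) :=
  ClosedSubspace canonical_image0 canonical_imageZD canonical_image_closed.

Definition derivative : completeNormedModType R :=
  quotientSpace canonical_image_subspace.

End Derivative.

Section Distortion.
Context {R : realType}.

(* S is T^-1; by the symmetry of the conditions each of T and S is a linear
   homeomorphism. *)
Definition isomorphic_with_distortion (X Y : normedModType R) (lambda : R) :=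
  exists (T : boundedOp X Y) (S : boundedOp Y X),
    [/\ cancel T S, cancel S T & `|T| * `|S| <= lambda].

(* Z is the range T(X), on which T^-1 is defined. *)
Definition embeds_with_distortion (X Y : normedModType R) (lambda : R) :=
  exists Z : closedSubspace Y,
    isomorphic_with_distortion X (subspaceType Z) lambda.

End Distortion.

(* Main.v *)
(** An operator [T : X -> Y] induces, through its biadjoint, an operator
    [Delta X / X -> Delta Y / Y] of norm at most [|T|]; functoriality settles
    isomorphisms.  When [T] maps [X] onto a closed subspace [Z] of [Y] with
    inverse [S], extending functionals from [Z] to [Y] gives
    [|phi| <= |S| |T** phi|].  Given [y] in [Y], a norm-one functional
    vanishing on [Z] and norming [y] modulo [Z] shows
    [dist (y, Z) <= |T** phi - y|], so [y] may be replaced by some [T x] at the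
    cost of doubling the distance:
    [dist (phi, X) <= 2 |S| dist (T** phi, Y)]. *)

From mathcomp Require Import boolp classical_sets sequences.
Require Import Defs.
From mathcomp Require Import all_boot all_order all_algebra.
From mathcomp Require Import reals topology normedtype.

Import GRing.Theory.
Local Open Scope ring_scope.
Import Order.TTheory Num.Theory.
Import numFieldNormedType.Exports.

Set Implicit Arguments.
Unset Strict Implicit.
Unset Printing Implicit Defensive.

(** Quotient norms are infima that need not be attained: estimates are made with representatives
    optimal up to [e], and [e] is then removed. Dividing by [|s| + 1] avoids a case distinction on
    [s]. *)
Lemma ler_mulD_gt0P {R : realType} (a b s : R) :
  (forall e, 0 < e -> a <= s * (b + e)) -> a <= s * b.
Proof.
move=> ab; apply/ler_addgt0Pr => e e0.
have s1 : 0 < `|s| + 1 by rewrite ltr_wpDl.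
rewrite (le_trans (ab (e / (`|s| + 1)) _)) ?divr_gt0// mulrDr lerD2l mulrCA.
rewrite ler_piMr ?(ltW e0)// ler_pdivrMr// mul1r.
by rewrite (le_trans (ler_norm s))// lerDl.
Qed.

(** * Operators bounded below *)

Section BoundedBelow.
Context {R : realType} {X : completeNormedModType R} {Y : normedModType R}.
Variables (T : boundedOp X Y) (c : R).
Hypothesis T_below : forall x, `|x| <= c * `|T x|.

(** If [T x_n] approaches [y], the lower bound makes [x_n] Cauchy, and completeness of [X] yields a
    preimage of [y]. *)
Lemma bounded_below_range_closed :
  closed [set y | exists x, T x = y]%classic.
Proof.
(* The sign of [c] is not known here; [C >= 1] can be divided by and also absorbs the bare distance
   [|y - T x|] below. *)
move=> y yT; pose C := `|c| + 1.
have C1 : 1 <= C by rewrite lerDr.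
have C0 : 0 < C by rewrite (lt_le_trans ltr01).
have TC u : `|u| <= C * `|T u|.
  by rewrite (le_trans (T_below u))// ler_wpM2r// (le_trans (ler_norm c))// lerDl.
(* With exponent [n.+1], two such errors add up to at most [2^-1 ^+ n]. *)
have /choice[x xy] : forall n, exists x : X,
    C * `|y - T x| < 2^-1 ^+ n.+1.
  move=> n.
  have d0 : 0 < 2^-1 ^+ n.+1 / C by rewrite divr_gt0// half_expr_gt0.
  have [_ [[x <-]]] := yT _ (nbhsx_ballx y _ d0).
  by rewrite -ball_normE /= ltr_pdivlMr// mulrC; exists x.
have [n m nm|l xl] := @rapidly_cauchy_cvg _ X x.
  rewrite (le_trans (TC _))// linearB/=.
  rewrite (le_trans (ler_wpM2l (ltW C0) (ler_distD y _ _)))// mulrDr.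
  rewrite [leRHS]splitr -exprSr lerD//; first by rewrite distrC ltW.
  apply: (le_trans (ltW (xy m))).
  by rewrite ler_wiXn2l ?invr_ge0 ?invf_le1 ?ler1n.
(* The distance from [y] to [T l] is at most [e + |T| * e], which explains the factor [1 + |T|]. *)
exists l; apply/esym/eqP; rewrite -subr_eq0 -normr_le0 -[leRHS](mulr0 (1 + `|T|)).
apply: ler_mulD_gt0P => e e0; rewrite add0r mulrDl mul1r.
have [N Ne] := half_expr_lt e0.
move/cvgrPdist_le : xl => /(_ _ e0)[M _ Me].
pose k := maxn N M.
rewrite (le_trans (ler_distD (T (x k)) _ _))// lerD//.
  apply: (@le_trans _ _ (C * `|y - T (x k)|)); first by rewrite ler_peMl.
  by rewrite ltW// (lt_trans (xy k))// Ne// leqW// leq_maxl.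
rewrite -linearB (le_trans (ler_boundedOp T _))// ler_wpM2l//.
by rewrite distrC Me//= leq_maxr.
Qed.

Lemma bounded_below_embeds : 0 <= c -> embeds_with_distortion X Y (`|T| * c).
Proof.
move=> c0.
have Z0 : exists x, T x = 0 by exists 0; rewrite linear0.
have ZZD (a : R) u v : (exists x, T x = u) -> (exists x, T x = v) ->
    exists x, T x = a *: u + v.
  by move=> [x <-] [y <-]; exists (a *: x + y); rewrite linearP.
pose Z := ClosedSubspace Z0 ZZD bounded_below_range_closed.
have TZ x : T x \in closedSubspace_pred Z.
  by apply/closedSubspace_predP; exists x.
pose T' x := SubspaceType (TZ x) : subspaceType Z.
have /choice[S' TS'] : forall z : subspaceType Z, exists x, T x = subspace_val z.
  exact: subspace_valP.
have Tinj x y : T x = T y -> x = y.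
  move=> Txy; apply/eqP; rewrite -subr_eq0 -normr_le0 (le_trans (T_below _))//.
  by rewrite linearB/= Txy subrr normr0 mulr0.
have T'P : T' \in bounded_linear.
  apply: (@mk_boundedOp_subproof _ _ _ _ `|T|) => [a u v|x].
    by apply: val_inj; rewrite /= linearP.
  exact: (ler_boundedOp T).
have S'c z : `|S' z| <= c * `|z|.
  by rewrite (le_trans (T_below _))// TS'.
have S'P : S' \in bounded_linear.
  apply: (mk_boundedOp_subproof _ S'c) => a u v.
  by apply: Tinj; rewrite (linearP T)/= !TS'.
exists Z, (BoundedOp T'P), (BoundedOp S'P); split.
- by move=> x; apply: Tinj; rewrite TS'.
- by move=> z; apply: val_inj; exact: TS'.
- by rewrite ler_wpM2l//; exact: boundedOp_norm_le.
Qed.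

End BoundedBelow.

(** * Operators induced on quotients *)

Section QuotientMap.
Context {R : realType} {V V' : normedModType R}.
Variables (W : closedSubspace V) (W' : closedSubspace V') (T : boundedOp V V').
Hypothesis TW : forall v, W v -> W' (T v).

Lemma quotient_map_exists :
  exists D : boundedOp (quotientSpace W) (quotientSpace W'),
  (forall v, D (quotient_proj W v) = quotient_proj W' (T v)) /\ `|D| <= `|T|.
Proof.
(* Quantifying over all representatives builds well-definedness, which is where [TW] enters, into
   the choice of [D]. *)
have /choice[D D_proj] : forall q : quotientSpace W, exists q' : quotientSpace W',
    forall v, quotient_proj W v = q -> q' = quotient_proj W' (T v).
  move=> q; have [u <-] := quotient_projP q; exists (quotient_proj W' (T u)).
  by move=> v /eq_quotient_proj/TW; rewrite linearB => vu;
    apply/esym/eq_quotient_proj.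
have DE v : D (quotient_proj W v) = quotient_proj W' (T v) by exact: D_proj.
have Dlin : linear D.
  move=> a p q; have [u <-] := quotient_projP p; have [v <-] := quotient_projP q.
  by rewrite -linearP !DE !linearP.
have Dbound q : `|D q| <= `|T| * `|q|.
  apply: ler_mulD_gt0P => e e0; have [v <- ve] := quotient_norm_lift q e0.
  rewrite DE (le_trans (quotient_proj_norm _ _))//.
  rewrite (le_trans (ler_boundedOp T v))// ler_wpM2l//.
  exact: ltW.
exists (BoundedOp (mk_boundedOp_subproof Dlin Dbound)); split=> //.
exact: boundedOp_norm_le.
Qed.

End QuotientMap.

(** * Extension of functionals and naturality of the canonical embedding *)

Section BidualLowerBound.
Context {R : realType} {X Y : normedModType R}.

(** Hahn-Banach applied to the graph of [f], dominated by the multiple [|f| * |y|] of the norm so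
    that the norm does not grow. *)
Lemma bounded_functional_extension (Z : closedSubspace Y)
    (f : dual (subspaceType Z)) :
  exists g : dual Y, `|g| <= `|f| /\ forall z : subspaceType Z, g z = f z.
Proof.
pose p (y : Y) : R := `|f| * `|y|.
have pD u v : p (u + v) <= p u + p v.
  by rewrite /p -mulrDr ler_wpM2l// ler_normD.
have pZ (a : R) v : 0 <= a -> p (a *: v) = a * p v.
  by move=> a0; rewrite /p normrZ ger0_norm// mulrCA.
pose G0 := [set ws : Y * R | exists z : subspaceType Z,
  ws = (subspace_val z, f z)]%classic.
have [| | |g [gl gp gG]] := hahn_banach pD pZ (G0 := G0).
- by exists (subspace_val (0 : subspaceType Z), f 0), 0.
- move=> a u v r s [b [-> ->]] [c [-> ->]]; exists (a *: b + c).
  by rewrite (linearP f).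
- move=> _ _ [z [-> ->]]; rewrite (le_trans (ler_norm _))//.
  exact: (ler_boundedOp f z).
have gn y : `|g y| <= `|f| * `|y|.
  (* Domination is one-sided; the lower bound follows by evaluating at [- y]. *)
  rewrite ler_norml [g y <= _]gp andbT lerNl.
  have g0 : g 0 = 0.
    by have := gl (-1) 0 0; rewrite !scaleN1r addr0 oppr0 addNr.
  have <- : g (- y) = - g y.
    by have := gl (-1) y 0; rewrite !scaleN1r g0 !addr0.
  by rewrite (le_trans (gp _))// /p normrN.
exists (BoundedOp (mk_boundedOp_subproof gl gn)); split.
  exact: boundedOp_norm_le.
by move=> z /=; apply: gG; exists z.
Qed.

Lemma biadjoint_canonical (T : boundedOp X Y) x :
  biadjoint T (canonical x) = canonical (T x).
Proof. exact: boundedOpP. Qed.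

End BidualLowerBound.

Lemma adjoint_norm {R : realType} {X Y : normedModType R} (T : boundedOp X Y) :
  `|adjoint T| <= `|T|.
Proof.
apply: boundedOp_norm_le => // g; apply: boundedOp_norm_le => [|x].
  by rewrite mulr_ge0.
rewrite (le_trans (ler_boundedOp g _))// [`|T| * _]mulrC -mulrA ler_wpM2l//.
exact: (ler_boundedOp T).
Qed.

(** * Lower estimates for the biadjoint of an embedding *)

Section EmbeddedBidual.
Context {R : realType} {X Y : normedModType R} {Z : closedSubspace Y}.
Variables (T : boundedOp X (subspaceType Z)) (S : boundedOp (subspaceType Z) X).

Lemma ambient_op_subproof :
  (fun x => subspace_val (T x)) \in bounded_linear.
Proof.
apply: (@mk_boundedOp_subproof _ _ _ _ `|T|) => [a u v|x].
  by rewrite linearP.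
exact: (ler_boundedOp T).
Qed.

Definition ambient_op : boundedOp X Y := BoundedOp ambient_op_subproof.

Lemma ambient_op_norm : `|ambient_op| = `|T|.
Proof. by []. Qed.

Lemma biadjoint_ambient_below (phi : bidual X) : cancel T S ->
  `|phi| <= `|S| * `|biadjoint ambient_op phi|.
Proof.
move=> TK; apply: boundedOp_norm_le => [|f]; first by rewrite mulr_ge0.
(* Extending [f] composed with [S] from [Z] to [Y] gives a preimage of [f] under the adjoint, of
   norm at most [|S| * |f|]. *)
have [g [gf gS]] := bounded_functional_extension (adjoint S f).
have gE : adjoint ambient_op g = f.
  by apply: boundedOpP => x; rewrite adjointE (gS (T x)) adjointE TK.
have -> : phi f = biadjoint ambient_op phi g by rewrite adjointE gE.
rewrite (le_trans (ler_boundedOp (biadjoint ambient_op phi) g))//.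
rewrite mulrAC [leLHS]mulrC ler_wpM2r// (le_trans gf)//.
rewrite (le_trans (ler_boundedOp (adjoint S) f))// ler_wpM2r//.
exact: adjoint_norm.
Qed.

(* Test against a norming functional of [Y / Z]: pulled back to [Y] it kills
   the range of the operator, hence also the biadjoint image of [phi]. *)
Lemma quotient_proj_norm_le_biadjoint (phi : bidual X) (y : Y) :
  `|quotient_proj Z y| <= `|biadjoint ambient_op phi - canonical y|.
Proof.
have projP : quotient_proj Z \in bounded_linear.
  apply: (@mk_boundedOp_subproof _ _ _ _ 1) => [|u]; first exact: linearP.
  by rewrite mul1r quotient_proj_norm.
have [h [h1 hy]] := norming_functional (quotient_proj Z y).
pose g := adjoint (BoundedOp projP) h.
have g1 : `|g| <= 1.
  apply: boundedOp_norm_le => // u; rewrite mul1r.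
  by rewrite (le_trans (h1 _))// quotient_proj_norm.
have g0 : adjoint ambient_op g = 0.
  apply: boundedOpP => x; rewrite adjointE [LHS]/=.
  rewrite (_ : quotient_proj Z _ = 0) ?linear0//.
  rewrite -(linear0 (quotient_proj Z)); apply/eq_quotient_proj; rewrite subr0.
  exact: subspace_valP.
have gE : (biadjoint ambient_op phi - canonical y) g = - `|quotient_proj Z y|.
  by rewrite -hy -[LHS]/(phi (adjoint ambient_op g) - g y) g0 linear0 sub0r.
rewrite -[leLHS]normr_id -[leLHS]normrN -gE (le_trans (ler_boundedOp _ _))//.
by rewrite ler_piMr.
Qed.

End EmbeddedBidual.

(** * Functoriality of the derivative *)

Section DerivativeMap.
Context {R : realType} (Delta : bidualAssignment R).
Context {X Y : completeNormedModType R}.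
Variable T : boundedOp X Y.

Lemma assignment_mem (phi : subspaceType (Delta X)) :
  biadjoint T (subspace_val phi) \in closedSubspace_pred (Delta Y).
Proof.
by apply/closedSubspace_predP/assignment_biadjoint; exact: subspace_valP.
Qed.

Lemma assignment_map_subproof :
  (fun phi => SubspaceType (assignment_mem phi)) \in bounded_linear.
Proof.
apply: (@mk_boundedOp_subproof _ _ _ _ `|T|) => [a u v|phi].
  by apply: val_inj; exact: (linearP (biadjoint T)).
apply: (le_trans (ler_boundedOp (biadjoint T) (subspace_val phi))).
rewrite ler_wpM2r// (le_trans (adjoint_norm _))//; exact: adjoint_norm.
Qed.

Definition assignment_map :
    boundedOp (subspaceType (Delta X)) (subspaceType (Delta Y)) :=
  BoundedOp assignment_map_subproof.

Lemma assignment_map_norm : `|assignment_map| <= `|T|.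
Proof.
apply: boundedOp_norm_le => // phi.
apply: (le_trans (ler_boundedOp (biadjoint T) (subspace_val phi))).
rewrite ler_wpM2r// (le_trans (adjoint_norm _))//; exact: adjoint_norm.
Qed.

(** By naturality the biadjoint sends the copy of [X] into that of [Y], so its restriction to
    [Delta X] descends to the quotients. *)
Lemma derivative_map_exists :
  exists D : boundedOp (derivative Delta X) (derivative Delta Y),
  (forall phi, D (quotient_proj (canonical_image_subspace Delta X) phi) =
     quotient_proj (canonical_image_subspace Delta Y) (assignment_map phi)) /\
  `|D| <= `|T|.
Proof.
have [|D [DE Dle]] := @quotient_map_exists _ _ _
  (canonical_image_subspace Delta X) (canonical_image_subspace Delta Y)
  assignment_map.
  move=> phi [x xphi]; exists (T x).
  by rewrite -biadjoint_canonical xphi.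
by exists D; split=> //; rewrite (le_trans Dle)// assignment_map_norm.
Qed.

End DerivativeMap.

(** Evaluated at [f], the composite is [phi] at [f] composed with [S] and [T], which is [f]
    itself. *)
Lemma assignment_mapK {R : realType} (Delta : bidualAssignment R)
    (X Y : completeNormedModType R) (T : boundedOp X Y) (S : boundedOp Y X) :
  cancel T S -> cancel (assignment_map Delta T) (assignment_map Delta S).
Proof.
move=> TK phi; apply/val_inj/boundedOpP => f.
rewrite -[LHS]/(subspace_val phi (adjoint T (adjoint S f))).
by congr (subspace_val phi _); apply: boundedOpP => x; rewrite !adjointE TK.
Qed.

(** * Distortion bounds for derivatives *)

Lemma derivative_isomorphic {R : realType} (Delta : bidualAssignment R)
    (X Y : completeNormedModType R) (lambda : R) :
  isomorphic_with_distortion X Y lambda ->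
  isomorphic_with_distortion (derivative Delta X) (derivative Delta Y) lambda.
Proof.
move=> [T [S [TK SK TS]]].
have [D [DE Dle]] := derivative_map_exists Delta T.
have [E [EE Ele]] := derivative_map_exists Delta S.
exists D, E; split.
- by move=> q; have [phi <-] := quotient_projP q; rewrite DE EE assignment_mapK.
- by move=> q; have [phi <-] := quotient_projP q; rewrite EE DE assignment_mapK.
- by rewrite (le_trans _ TS)// ler_pM.
Qed.

Lemma derivative_embeds {R : realType} (Delta : bidualAssignment R)
    (X Y : completeNormedModType R) (lambda : R) :
  embeds_with_distortion X Y lambda ->
  embeds_with_distortion (derivative Delta X) (derivative Delta Y) (2 * lambda).
Proof.
move=> [Z [T [S [TK SK TS]]]]; pose J := ambient_op T.
have [D [DE Dle]] := derivative_map_exists Delta J.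
have Dbelow q : `|q| <= `|S| * 2 * `|D q|.
  apply: ler_mulD_gt0P => e e0; have e20 : 0 < e / 2 by rewrite divr_gt0.
  have [phi <-] := quotient_projP q; rewrite DE.
  set PX := quotient_proj _; set PY := quotient_proj _.
  (* [psi] is the biadjoint image of [phi] minus some [y] in [Y], nearly as short as possible. *)
  have [psi psiE psie] := quotient_norm_lift (PY (assignment_map Delta J phi)) e20.
  have [y /= yE] : canonical_image (assignment_map Delta J phi - psi).
    by apply/(@eq_quotient_proj _ _ (canonical_image_subspace Delta Y)).
    have Jphi : biadjoint J (subspace_val phi) - canonical y = subspace_val psi.
    by rewrite yE opprB addrC subrK.
  have := quotient_proj_norm_le_biadjoint T (subspace_val phi) y.
  rewrite Jphi => yZ.
  (* [y2] is a nearly shortest element of [y + Z], so [y - y2] lies in [Z] and equals [J x] for some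
     [x]. *)
  have [y2 /esym/eq_quotient_proj y2E y2e] := quotient_norm_lift (quotient_proj Z y) e20.
  have /closedSubspace_predP y2Z := y2E.
  pose x := S (SubspaceType y2Z).
  have Jx : J x = y - y2 by rewrite /= SK.
  have xP : canonical x \in closedSubspace_pred (Delta X).
    by apply/closedSubspace_predP; exact: assignment_canonical.
  (* Subtracting [x] keeps the class of [phi] and turns its biadjoint image into [psi + y2]. *)
  have -> : PX phi = PX (phi - SubspaceType xP).
    apply/eq_quotient_proj; rewrite opprB addrC subrK.
    by exists x.
  rewrite (le_trans (quotient_proj_norm _ _))//.
  rewrite (le_trans (biadjoint_ambient_below _ TK))// -mulrA ler_wpM2l//.
  have Jphix : biadjoint J (subspace_val phi - canonical x) =
      subspace_val psi + canonical y2.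
    rewrite linearB -Jphi -addrA; congr (_ + _).
    by rewrite [X in - X](biadjoint_canonical J x) Jx linearB opprB addrC.
  rewrite [biadjoint _ _]Jphix (le_trans (ler_normD _ _))// canonical_norm.
  have y2psi : `|y2| <= `|psi| + e / 2 by rewrite (le_trans (ltW y2e))// lerD2r.
  have psiD : `|psi| + e / 2 <= `|PY (assignment_map Delta J phi)| + e.
    by rewrite [e in leRHS]splitr addrA lerD2r ltW.
  (* The factor 2: [|psi|] and [|y2|] are each at most the quotient norm plus [e]. *)
  rewrite mulr_natl mulr2n lerD//; last exact: le_trans psiD.
  by rewrite (le_trans _ psiD)// lerDl ltW.
have S20 : 0 <= `|S| * 2 by rewrite mulr_ge0.
have [W [T' [S' [T'K S'K TS']]]] := bounded_below_embeds Dbelow S20.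
exists W, T', S'; split=> //; rewrite (le_trans TS')// mulrA mulrC ler_wpM2l//.
by rewrite (le_trans _ TS)// ler_wpM2r// -(ambient_op_norm T).
Qed.

Theorem theorem3p7 (R : realType) (Delta : bidualAssignment R)
    (X Y : completeNormedModType R) (lambda : R) :
  (embeds_with_distortion X Y lambda ->
   embeds_with_distortion (derivative Delta X) (derivative Delta Y)
     (2 * lambda)) /\
  (isomorphic_with_distortion X Y lambda ->
   isomorphic_with_distortion (derivative Delta X) (derivative Delta Y)
     lambda).
Proof.
split; first exact: derivative_embeds.
exact: derivative_isomorphic.
Qed.
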